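(* Let $P$ be a path graph with vertices $v_1,v_2,\ldots,v_n$ (in order along $P$) embedded in a metric space, where the distance $|v_iv_j|$ between any two vertices can be obtained in $O(1)$ time and the edge $e(v_i,v_{i+1})$ of $P$ has length $|v_iv_{i+1}|$ for $i\in[1,n-1]$. The discrete radius optimally augmenting path problem on $P$ — find an index pair $(i,j)$ with $1\le i<j\le n$ minimizing the radius of $G(i,j)$, and report such a pair together with a center and the radius — can be solved in $O(n)$ time.
   Context: The distance function satisfies: $|v_iv_j|=0$ iff $i=j$; $|v_iv_j|=|v_jv_i|\ge 0$; and the triangle inequality $|v_iv_k|+|v_kv_j|\ge |v_iv_j|$. For $1\le i\le j\le n$, $G(i,j)=P\cup\{e(v_i,v_j)\}$ is the graph obtained by adding to $P$ a new edge $e(v_i,v_j)$ of length $|v_iv_j|$ (if $j\in\{i,i+1\}$ then $G(i,j)=P$). For a graph $G$ and vertices $v,v'$, $d_G(v,v')$ denotes the shortest path length from $v$ to $v'$ in $G$. A center of $G$ is a vertex $v_c$ of $G$ (centers are restricted to vertices) minimizing $\max_{v'} d_G(v_c,v')$, and this minimum value is the radius of $G$. *)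

(* Defs.v *)
From mathcomp Require Import all_boot all_order all_algebra.
From mathcomp Require Import boolp classical_sets reals.

Set Implicit Arguments.
Unset Strict Implicit.
Unset Printing Implicit Defensive.

Import Order.TTheory GRing.Theory Num.Theory.
Local Open Scope ring_scope.
Local Open Scope classical_set_scope.

(** * Weighted graphs: shortest paths, centers, radius

    A graph on [V] is a (symmetric) relation [e] with edge lengths [w].
    Every set of reals below is finite, and nonempty when the graph is connected
    and has a vertex, so that [inf] is a minimum and [sup] a maximum. *)

Definition path_length (R : realType) (V : finType) (w : V -> V -> R)
    (u : V) (p : seq V) : R :=
  \sum_(xy <- zip (u :: p) p) w xy.1 xy.2.

Definition simple_path (V : finType) (e : rel V) (u v : V) (p : seq V) : bool :=
  [&& path e u p, last u p == v & uniq (u :: p)].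

Definition graph_dist (R : realType) (V : finType) (e : rel V)
    (w : V -> V -> R) (u v : V) : R :=
  inf [set path_length w u p | p in [set p | simple_path e u v p]].

Definition eccentricity (R : realType) (V : finType) (e : rel V)
    (w : V -> V -> R) (u : V) : R :=
  sup [set graph_dist e w u v | v in [set: V]].

Definition radius (R : realType) (V : finType) (e : rel V)
    (w : V -> V -> R) : R :=
  inf [set eccentricity e w u | u in [set: V]].

Definition is_center (R : realType) (V : finType) (e : rel V)
    (w : V -> V -> R) (c : V) : Prop :=
  forall u : V, eccentricity e w c <= eccentricity e w u.

(** * The problem

    The vertices are numbered from 0: [i : 'I_n] stands for v_(i+1). *)

Definition is_metric (R : realType) (n : nat) (d : 'I_n -> 'I_n -> R) : Prop :=
  [/\ forall i j, d i j = 0 <-> i = j,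
      forall i j, 0 <= d i j,
      forall i j, d i j = d j i
    & forall i j k, d i j <= d i k + d k j].

Definition path_edge (n : nat) : rel 'I_n :=
  fun u v => (u.+1 == v :> nat) || (v.+1 == u :> nat).

(* All the edges of G(i,j), old and new, have the length given by the metric, so
   that G(i,j) is the relation [aug_edge i j] weighted by the metric. *)
Definition aug_edge (n : nat) (i j : 'I_n) : rel 'I_n :=
  fun u v => [|| path_edge u v, (u == i) && (v == j) | (u == j) && (v == i)].

Definition optimal_augmentation (R : realType) (n : nat)
    (d : 'I_n -> 'I_n -> R) (i j c : 'I_n) (r : R) : Prop :=
  [/\ (i < j)%N,
      forall i' j' : 'I_n, (i' < j')%N ->
        radius (aug_edge i j) d <= radius (aug_edge i' j') d,
      is_center (aug_edge i j) d c
    & r = radius (aug_edge i j) d].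

(** * The model of computation: a real RAM with a distance oracle

    The memory consists of integer arrays and real arrays, named by natural
    numbers (a program names finitely many of them) and initially filled with
    zeros.  Cell 0 of an array can serve as a scalar variable.  Integers are
    machine words: an operation whose result is not smaller than the word bound
    [W] has no result, and neither has a division by zero nor a call of the
    oracle on a number that is not a vertex; a program which evaluates such an
    expression is stuck.  Reals are only subject to the field operations and to
    comparisons; in particular no rounding is available. *)

Inductive iop := IAdd | ISub | IMul | IDiv.
Inductive rop := RAdd | RSub | RMul | RDiv.

Inductive iexp :=
  | INum of nat
  | ILoad of nat & iexp            (* array, index *)
  | IOp of iop & iexp & iexp.

Inductive rexp :=
  | RNum of nat
  | RLoad of nat & iexp
  | RDist of iexp & iexp
  | ROp of rop & rexp & rexp.

Inductive bexp :=
  | BIlt of iexp & iexp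
  | BRlt of rexp & rexp
  | BNot of bexp
  | BAnd of bexp & bexp.

Inductive cmd :=
  | CSkip
  | CIStore of nat & iexp & iexp   (* array, index, value *)
  | CRStore of nat & iexp & rexp
  | CSeq of cmd & cmd
  | CIf of bexp & cmd & cmd
  | CWhile of bexp & cmd.

Record store (R : realType) := Store {
  ints : nat -> nat -> nat;        (* array, index *)
  reals : nat -> nat -> R
}.

Definition update (T : Type) (m : nat -> nat -> T) (a i : nat) (x : T) :
    nat -> nat -> T :=
  fun b j => if (b == a) && (j == i) then x else m b j.

Definition store_int (R : realType) (s : store R) (a i x : nat) : store R :=
  Store (update (ints s) a i x) (reals s).

Definition store_real (R : realType) (s : store R) (a i : nat) (x : R) :
    store R :=
  Store (ints s) (update (reals s) a i x).

Definition obind2 (A B C : Type) (f : A -> B -> option C)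
    (x : option A) (y : option B) : option C :=
  obind (fun a => obind (f a) y) x.

Definition word (W x : nat) : option nat := if (x < W)%N then Some x else None.

(* [ISub] is truncated subtraction, [IDiv] the integer quotient. *)
Definition apply_iop (W : nat) (o : iop) (x y : nat) : option nat :=
  match o with
  | IAdd => word W (x + y)%N
  | ISub => word W (x - y)%N
  | IMul => word W (x * y)%N
  | IDiv => if y == 0%N then None else word W (x %/ y)%N
  end.

Definition apply_rop (R : realType) (o : rop) (x y : R) : option R :=
  match o with
  | RAdd => Some (x + y)
  | RSub => Some (x - y)
  | RMul => Some (x * y)
  | RDiv => if y == 0 then None else Some (x / y)
  end.

Definition oracle (R : realType) (n : nat) (d : 'I_n -> 'I_n -> R)
    (x y : nat) : option R :=
  obind2 (fun i j => Some (d i j)) (insub x : option 'I_n) (insub y).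

Fixpoint ieval (R : realType) (W : nat) (s : store R) (e : iexp) : option nat :=
  match e with
  | INum k => word W k
  | ILoad a e1 => omap (ints s a) (ieval W s e1)
  | IOp o e1 e2 => obind2 (apply_iop W o) (ieval W s e1) (ieval W s e2)
  end.

Fixpoint reval (R : realType) (n : nat) (d : 'I_n -> 'I_n -> R) (W : nat)
    (s : store R) (e : rexp) : option R :=
  match e with
  | RNum k => Some k%:R
  | RLoad a e1 => omap (reals s a) (ieval W s e1)
  | RDist e1 e2 => obind2 (oracle d) (ieval W s e1) (ieval W s e2)
  | ROp o e1 e2 => obind2 (@apply_rop R o) (reval d W s e1) (reval d W s e2)
  end.

Fixpoint beval (R : realType) (n : nat) (d : 'I_n -> 'I_n -> R) (W : nat)
    (s : store R) (b : bexp) : option bool :=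
  match b with
  | BIlt e1 e2 =>
      obind2 (fun x y => Some (x < y)%N) (ieval W s e1) (ieval W s e2)
  | BRlt e1 e2 =>
      obind2 (fun x y => Some (x < y)) (reval d W s e1) (reval d W s e2)
  | BNot b1 => omap negb (beval d W s b1)
  | BAnd b1 b2 =>
      obind2 (fun x y => Some (x && y)) (beval d W s b1) (beval d W s b2)
  end.

(* Evaluating an expression takes one unit of time per node: every arithmetic
   operation, comparison, memory access and oracle call has unit cost. *)
Fixpoint icost (e : iexp) : nat :=
  match e with
  | INum _ => 1
  | ILoad _ e1 => (icost e1).+1
  | IOp _ e1 e2 => (icost e1 + icost e2).+1
  end%N.

Fixpoint rcost (e : rexp) : nat :=
  match e with
  | RNum _ => 1
  | RLoad _ e1 => (icost e1).+1
  | RDist e1 e2 => (icost e1 + icost e2).+1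
  | ROp _ e1 e2 => (rcost e1 + rcost e2).+1
  end%N.

Fixpoint bcost (b : bexp) : nat :=
  match b with
  | BIlt e1 e2 => (icost e1 + icost e2).+1
  | BRlt e1 e2 => (rcost e1 + rcost e2).+1
  | BNot b1 => (bcost b1).+1
  | BAnd b1 b2 => (bcost b1 + bcost b2).+1
  end%N.

(* [exec d W c s t s']: started in [s], the program [c] halts in [s'] after
   exactly [t] units of time. *)
Inductive exec (R : realType) (n : nat) (d : 'I_n -> 'I_n -> R) (W : nat) :
    cmd -> store R -> nat -> store R -> Prop :=
  | ExecSkip s : exec d W CSkip s 1 s
  | ExecIStore s a e1 e2 i x :
      ieval W s e1 = Some i -> ieval W s e2 = Some x ->
      exec d W (CIStore a e1 e2) s (icost e1 + icost e2).+1%N (store_int s a i x)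
  | ExecRStore s a e1 e2 i x :
      ieval W s e1 = Some i -> reval d W s e2 = Some x ->
      exec d W (CRStore a e1 e2) s (icost e1 + rcost e2).+1%N (store_real s a i x)
  | ExecSeq s s1 s2 c1 c2 t1 t2 :
      exec d W c1 s t1 s1 -> exec d W c2 s1 t2 s2 ->
      exec d W (CSeq c1 c2) s (t1 + t2)%N s2
  | ExecIf s s1 b c1 c2 (v : bool) t :
      beval d W s b = Some v -> exec d W (if v then c1 else c2) s t s1 ->
      exec d W (CIf b c1 c2) s (bcost b + t).+1%N s1
  | ExecWhileFalse s b c :
      beval d W s b = Some false ->
      exec d W (CWhile b c) s (bcost b).+1 s
  | ExecWhileTrue s s1 s2 b c t1 t2 :
      beval d W s b = Some true ->
      exec d W c s t1 s1 -> exec d W (CWhile b c) s1 t2 s2 ->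
      exec d W (CWhile b c) s (bcost b + t1 + t2).+1%N s2.

(* The number of vertices is the only input besides the oracle; it is found in
   cell 0 of integer array 0. *)
Definition init_store (R : realType) (n : nat) : store R :=
  Store (update (fun _ _ => 0%N) 0 0 n) (fun _ _ => 0).

(* The indices of the pair and of the center are returned in cells 1, 2 and 3 of
   integer array 0, and the radius in cell 0 of real array 0. *)
Definition output_correct (R : realType) (n : nat) (d : 'I_n -> 'I_n -> R)
    (s : store R) : Prop :=
  exists i j c : 'I_n,
    [/\ ints s 0 1 = i, ints s 0 2 = j, ints s 0 3 = c
      & optimal_augmentation d i j c (reals s 0 0)].

(* Main.v *)
Require Import Defs.
From mathcomp Require Import all_boot all_order all_algebra.
From mathcomp Require Import boolp classical_sets reals.
From mathcomp Require Import zify lra.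

(* An optimal new edge may be assumed to start at the center c: a shortest path
   tree rooted at c crosses the edge in one direction only, say from i to j, and
   the edge from c to j is as good.  Reversing the path if necessary, c comes
   before j.  Writing X for the positions along the path and L for its length,
   a cost E is then achievable iff for some q > c the vertices before the q-th
   are within E of c along the path and the others are within E through j:

     X c <= E,   X (q-1) - X c <= E,   d(c,j) + max (L - X j) (X j - X q) <= E.

   By the triangle inequality d(c,j) - X j decreases and d(c,j) + X j increases
   with j, so that the best j is one of the two vertices around the midpoint of
   X q and L, and the midpoints advance with q.  For a fixed c the second cost
   increases and the third one decreases with q, so that the best q is at their
   crossing or just before it; the crossing advances with c because
   d(c,j) + X c increases with c.  Hence two pointers suffice. *)

Set Implicit Arguments.
Unset Strict Implicit.
Unset Printing Implicit Defensive.

Import Order.TTheory GRing.Theory Num.Theory.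
Local Open Scope ring_scope.

(** * Distances, eccentricities and radius *)

Section Graphs.
Variables (R : realType) (V : finType) (e : rel V) (w : V -> V -> R).
Hypothesis w_ge0 : forall u v, 0 <= w u v.

Lemma path_length_nil u : path_length w u [::] = 0.
Proof. by rewrite /path_length big_nil. Qed.

Lemma path_length_cons u x p :
  path_length w u (x :: p) = w u x + path_length w x p.
Proof. by rewrite /path_length /= big_cons. Qed.

Lemma path_length_ge0 u p : 0 <= path_length w u p.
Proof. by apply: sumr_ge0 => -[]. Qed.

Lemma path_length_cat u p q :
  path_length w u (p ++ q) = path_length w u p + path_length w (last u p) q.
Proof.
elim: p u => [|x p IHp] u /=; first by rewrite path_length_nil add0r.
by rewrite !path_length_cons IHp addrA.
Qed.

(** Walks may repeat vertices and [l] is only an upper bound, so that walks extend freely, unlike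
    the simple paths in [graph_dist]. *)
Definition walk (u v : V) (l : R) : Prop :=
  exists p, [/\ path e u p, last u p = v & path_length w u p <= l].

Lemma walk_refl u l : 0 <= l -> walk u u l.
Proof. by exists [::]; split=> //; rewrite path_length_nil. Qed.

Lemma walk_step u x v l : e u x -> walk x v (l - w u x) -> walk u v l.
Proof.
move=> eux [p [xp <- lp]]; exists (x :: p); split=> //=; first by rewrite eux.
by rewrite path_length_cons; lra.
Qed.

(** The tail is made simple by induction; if [u] occurs in it again, the cycle is cut out, which
    lengthens nothing as weights are nonnegative. *)
Lemma walk_simple u v l : walk u v l ->
  exists2 p, simple_path e u v p & path_length w u p <= l.
Proof.
case=> p [+ <- +] {v}; elim: p u l => [|x p IHp] u l /=.
  by move=> _ l_ge0; exists [::]; rewrite // /simple_path /= eqxx.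
case/andP=> eux xp; rewrite path_length_cons => pl.
have [||q /and3P[xq lq uq] ql] := IHp x (l - w u x) => //; first lra.
have [uxq|uxq] := boolP (u \in x :: q); last first.
  exists (x :: q); first by rewrite /simple_path /= eux xq lq uxq.
  by rewrite path_length_cons; lra.
have xql : path_length w x q <= l by have := w_ge0 u x; lra.
move: uxq; rewrite inE => /predU1P[-> | uq'].
  by exists q => //; rewrite /simple_path xq lq.
case/path.splitP: uq' xq lq uq xql {ql} => q1 q2.
rewrite cat_path last_cat !last_rcons -cat_cons cat_uniq => /andP[_ q2p] lq.
case/and3P=> _ hq uq2; rewrite path_length_cat last_rcons => ql.
exists q2; last by have := path_length_ge0 x (rcons q1 u); lra.
rewrite /simple_path q2p lq /= uq2 andbT.
apply: contra hq => uq'; apply/hasP; exists u => //=.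
by rewrite inE mem_rcons mem_head orbT.
Qed.

Lemma graph_dist_le u v l : walk u v l -> graph_dist e w u v <= l.
Proof.
case/walk_simple=> p sp pl; apply: le_trans pl; apply: ge_inf; last by exists p.
by exists 0 => _ [q _ <-]; apply: path_length_ge0.
Qed.

(** The growth of the potential [phi] telescopes along any path. The walk ensures that the infimum
    ranges over a nonempty set. *)
Lemma graph_dist_ge (phi : V -> R) u v l : walk u v l -> phi u = 0 ->
  (forall a b, e a b -> phi b <= phi a + w a b) -> phi v <= graph_dist e w u v.
Proof.
case/walk_simple=> p sp _ phi0 phi_lip; apply: lb_le_inf.
  by exists (path_length w u p), p.
move=> _ [q /and3P[uq /eqP<- _] <-].
rewrite -[leRHS]add0r -phi0 {sp phi0 p}.
elim: q u uq => [|x q IHq] u /=; first by rewrite path_length_nil addr0.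
case/andP=> /phi_lip h1 /IHq h2; rewrite path_length_cons; lra.
Qed.

Lemma graph_dist_le_ecc u v : graph_dist e w u v <= eccentricity e w u.
Proof.
apply: ub_le_sup; last by exists v.
exists (\sum_v `|graph_dist e w u v|) => _ [z _ <-].
rewrite (bigD1 z) //=; apply: le_trans (ler_norm _) _.
by rewrite lerDl sumr_ge0.
Qed.

Lemma ecc_le u l : (forall v, graph_dist e w u v <= l) ->
  eccentricity e w u <= l.
Proof.
move=> h; apply: ge_sup; first by exists (graph_dist e w u u), u.
by move=> _ [v _ <-].
Qed.

Lemma radius_le_ecc u : radius e w <= eccentricity e w u.
Proof.
apply: ge_inf; last by exists u.
exists (- \sum_v `|eccentricity e w v|) => _ [z _ <-].
rewrite lerNl (bigD1 z) //= -normrN; apply: le_trans (ler_norm _) _.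
by rewrite lerDl sumr_ge0.
Qed.

Lemma radius_ge (u : V) l : (forall v, l <= eccentricity e w v) ->
  l <= radius e w.
Proof.
move=> h; apply: lb_le_inf; first by exists (eccentricity e w u), u.
by move=> _ [v _ <-].
Qed.

End Graphs.

(** * Costs of a center, a split and a jump *)

(** Indices are natural numbers rather than ordinals, so that successors, predecessors and reversals
    are plain arithmetic. *)
Definition metric_below (R : realType) (n : nat) (D : nat -> nat -> R) : Prop :=
  [/\ forall a, (a < n)%N -> D a a = 0,
      forall a b, (a < n)%N -> (b < n)%N -> 0 <= D a b,
      forall a b, (a < n)%N -> (b < n)%N -> D a b = D b a
    & forall a b c, (a < n)%N -> (b < n)%N -> (c < n)%N ->
        D a b <= D a c + D c b].

Definition pos (R : realType) (D : nat -> nat -> R) (k : nat) : R :=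
  \sum_(i < k) D i i.+1.

(** Only two kinds of routes are allowed: along the path, or first the new edge from [c] to [j] and
    then the path. *)
Definition reach (R : realType) (n : nat) (D : nat -> nat -> R) (c j : nat)
    (E : R) : Prop :=
  forall v, (v < n)%N -> `|pos D v - pos D c| <= E \/
    D c j + `|pos D j - pos D v| <= E.

Lemma norm_subr_le (R : realType) (x y l : R) :
  x - y <= l -> y - x <= l -> `|x - y| <= l.
Proof. by move=> h1 h2; rewrite ler_norml lerNl opprB h2 h1. Qed.

Section Metric.
Variables (R : realType) (n : nat) (D : nat -> nat -> R).
Hypothesis D_metric : metric_below n D.

Local Notation X := (pos D).
Local Notation L := (X n.-1).

Lemma pos0 : X 0 = 0. Proof. by rewrite /pos big_ord0. Qed.

Lemma posS k : X k.+1 = X k + D k k.+1.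
Proof. by rewrite /pos big_ord_recr. Qed.

Lemma dist_le_posB a b : (a <= b)%N -> (b < n)%N -> D a b <= X b - X a.
Proof.
case: D_metric => D0 D_ge0 _ D_tri; elim: b => [|b IHb].
  by rewrite leqn0 => /eqP-> n_gt0; rewrite D0 ?subrr.
rewrite leq_eqVlt ltnS => /predU1P[-> bn|ab bn]; first by rewrite D0 ?subrr.
have bn' := ltnW bn; have := D_tri a b.+1 b (leq_ltn_trans ab bn') bn bn'.
by have := IHb ab bn'; rewrite posS; lra.
Qed.

Lemma pos_mono a b : (a <= b)%N -> (b < n)%N -> X a <= X b.
Proof.
case: D_metric => _ D_ge0 _ _ ab bn.
have := D_ge0 a b (leq_ltn_trans ab bn) bn.
by have := dist_le_posB ab bn; lra.
Qed.

Lemma dist_le_pos a b : (a < n)%N -> (b < n)%N -> D a b <= `|X a - X b|.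
Proof.
case: D_metric => _ _ D_sym _ an bn.
have [ab|/ltnW ba] := leqP a b.
  by rewrite distrC; apply: le_trans (ler_norm _); apply: dist_le_posB.
by rewrite D_sym //; apply: le_trans (ler_norm _); apply: dist_le_posB.
Qed.

(* The cost [E] is reached from [c] through [j] when the vertices before the
   [q]-th are served along the path and the others from [j]. *)
Definition split_cost_le (c q j : nat) (E : R) : Prop :=
  [/\ X c <= E, X q.-1 - X c <= E, D c j + (L - X j) <= E
    & D c j + (X j - X q) <= E].

(** The vertices up to [c], those between [c] and [q], and those from [q] on form three segments; in
    each of them an endpoint is the worst case. *)
Lemma reach_of_split c q j E :
  (c < q <= j)%N -> (j < n)%N -> split_cost_le c q j E -> reach n D c j E.
Proof.
case/andP=> cq qj jn [E1 E2 E3 E4] v vn.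
have X0 : 0 <= X 0 by rewrite pos0.
have := @pos_mono 0 v isT vn; have vL := @pos_mono v n.-1 ltac:(lia) ltac:(lia).
have [vc|cv] := leqP v c.
  have := pos_mono vc ltac:(lia); left; apply: norm_subr_le; lra.
have := pos_mono (ltnW cv) vn.
have [vq|qv] := ltnP v q.
  by have := @pos_mono v q.-1 ltac:(lia) ltac:(lia); left; apply: norm_subr_le; lra.
right; have qv_le := pos_mono qv vn.
suff : `|X j - X v| <= E - D c j by lra.
apply: norm_subr_le; lra.
Qed.

(** The split is the first vertex after [c] farther than [E] along the path: from there on only the
    route through [j] remains. *)
Lemma split_of_reach c j E : (c < j < n)%N -> reach n D c j E ->
  exists q j', [/\ (c < q < n)%N, (j' < n)%N & split_cost_le c q j' E].
Proof.
case/andP=> cj jn cE.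
have X0 := pos0.
(* If vertex 0 is served through [j], the way back from [j] passes over [c], so the bound holds in
   both cases. *)
have Ec : X c <= E.
  have := @pos_mono 0 c isT ltac:(lia); have := pos_mono (ltnW cj) jn.
  case: D_metric => _ /(_ c j ltac:(lia) jn) + _ _.
  by have [] := cE 0%N ltac:(lia); rewrite ?X0 => h1 h2 h3 h4;
    have := ler_norm (0 - X c); have := ler_norm (X c - 0);
    have := ler_norm (X j - 0); have := distrC (X c) 0; lra.
(* When no vertex after [c] is far, the last vertex serves both as split and as jump, its distance
   being at most the path length. *)
have [far|near] := pselect (exists v, (c < v < n)%N && (E < X v - X c)); last first.
  exists n.-1, n.-1; split; [lia | lia | ].
  have En : X n.-1 - X c <= E.
    rewrite leNgt; apply/negP=> h; apply: near; exists n.-1.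
    by rewrite h andbT; lia.
  have := @dist_le_posB c n.-1 ltac:(lia) ltac:(lia).
  have := @pos_mono n.-2 n.-1 ltac:(lia) ltac:(lia).
  by split; lra.
case: (ex_minnP far) => q /andP[/andP[cq qn] qE] q_min; exists q, j.
split; [lia | by [] |].
have D_ge0 : forall v, (q <= v < n)%N -> D c j + `|X j - X v| <= E.
  move=> v /andP[qv vn]; case: (cE v vn) => // h.
  by have := pos_mono qv vn; have := ler_norm (X v - X c); lra.
have h1 := D_ge0 q ltac:(lia); have h2 := D_ge0 n.-1 ltac:(lia).
have n1 := ler_norm (X j - X q); have n2 := ler_norm (X n.-1 - X j).
rewrite distrC in n2; split; [by [] | | lra | lra].
have [qc|cq'] := leqP q.-1 c.
  by have := @pos_mono q.-1 c qc ltac:(lia); have := cE c ltac:(lia);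
     have := normr_ge0 (X j - X q); case: (D_metric) => _ /(_ c j ltac:(lia) jn) + _ _;
     lra.
rewrite leNgt; apply/negP=> h; suff: (q <= q.-1)%N by lia.
by apply: q_min; rewrite cq' h andbT; lia.
Qed.

(** * Monotonicity, best jumps and the crossing of the two costs *)

Lemma dist_subpos_anti c j j' : (c < n)%N -> (j <= j')%N -> (j' < n)%N ->
  D c j' - X j' <= D c j - X j.
Proof.
case: D_metric => _ _ _ D_tri cn jj' j'n; have jn := leq_ltn_trans jj' j'n.
have := D_tri c j' j cn j'n jn; have := dist_le_posB jj' j'n; lra.
Qed.

Lemma dist_addpos_mono c j j' : (c < n)%N -> (j <= j')%N -> (j' < n)%N ->
  D c j + X j <= D c j' + X j'.
Proof.
case: D_metric => _ _ D_sym D_tri cn jj' j'n; have jn := leq_ltn_trans jj' j'n.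
have := D_tri c j j' cn jn j'n; rewrite (D_sym j' j) //.
have := dist_le_posB jj' j'n; lra.
Qed.

Lemma dist_addpos_mono_l c c' j : (j < n)%N -> (c <= c')%N -> (c' < n)%N ->
  D c j + X c <= D c' j + X c'.
Proof.
case: (D_metric) => _ _ D_sym D_tri jn cc' c'n; have cn := leq_ltn_trans cc' c'n.
by have := dist_addpos_mono jn cc' c'n; rewrite !(D_sym j).
Qed.

(** [p] is the last vertex not beyond the midpoint of [X q] and [L]; both sides are doubled, as in
    the test made by the program. *)
Definition midpoint (q p : nat) : Prop :=
  [/\ (q <= p < n)%N, X p + X p <= X q + L
    & (p.+1 < n)%N -> X q + L < X p.+1 + X p.+1].

(** The disjunction stands for a bound on a maximum: [h] is the minimum over all jumps of the larger
    of the two costs, attained at [j]. *)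
Definition best_jump (c q j : nat) (h : R) : Prop :=
  [/\ (q <= j < n)%N, D c j + (L - X j) <= h, D c j + (X j - X q) <= h
    & forall j', (j' < n)%N ->
        h <= D c j' + (L - X j') \/ h <= D c j' + (X j' - X q)].

(** At [p] the cost towards the end of the path dominates, at [p.+1] the cost towards [q]; by
    monotonicity all other jumps compare with one of these two. *)
Lemma best_jump_midpoint c q p : (c < n)%N -> midpoint q p ->
  ((p.+1 < n)%N -> D c p + (L - X p) <= D c p.+1 + (X p.+1 - X q)) ->
  best_jump c q p (D c p + (L - X p)).
Proof.
move=> cn [/andP[qp pn] mid1 mid2] le; split=> //; [lia | lra |].
move=> j jn; have [jp|pj] := leqP j p.
  by left; have := dist_subpos_anti cn jp pn; lra.
right; have := dist_addpos_mono cn pj jn.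
by have := le ltac:(lia); lra.
Qed.

Lemma best_jump_midpointS c q p : (c < n)%N -> midpoint q p -> (p.+1 < n)%N ->
  D c p.+1 + (X p.+1 - X q) <= D c p + (L - X p) ->
  best_jump c q p.+1 (D c p.+1 + (X p.+1 - X q)).
Proof.
move=> cn [/andP[qp pn] mid1 mid2] pn' le; have := mid2 pn'.
split=> //; [lia | lra |].
move=> j jn; have [jp|pj] := leqP j p.
  by left; have := dist_subpos_anti cn jp pn; lra.
by right; have := dist_addpos_mono cn pj jn; lra.
Qed.

(** The split is strictly before the crossing: serving along the path is cheaper than the larger
    cost of any jump. *)
Definition split_early (c q : nat) : Prop :=
  forall j, (j < n)%N ->
    X q.-1 - X c < D c j + (L - X j) \/ X q.-1 - X c < D c j + (X j - X q).

Lemma split_early_step c c' q : (c <= c')%N -> (c' < n)%N ->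
  split_early c q -> split_early c' q.
Proof.
move=> cc' c'n early j jn; have := dist_addpos_mono_l jn cc' c'n.
by case: (early j jn) => h1 h2; [left | right]; lra.
Qed.

Definition beats (best : R) (c q : nat) : Prop :=
  forall j E, (j < n)%N -> split_cost_le c q j E -> best <= E.

Lemma beats_le b b' c q : b' <= b -> beats b c q -> beats b' c q.
Proof. by move=> bb' hb j E jn /hb h; apply: le_trans bb' (h _). Qed.

(** A split before [q] can be moved to [q.-1]: there the path cost is still below the jump cost,
    which only drops. A split after [q] has path cost at least that of [q], hence at least [h], so
    the best jump of [q] does as well. *)
Lemma beats_all best c q :
  (c < q < n)%N ->
  (forall q', (c < q' < q)%N -> split_early c q') ->
  q.+1 = n \/ (exists j h, best_jump c q j h /\ h <= X q.-1 - X c) ->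
  beats best c q -> ((c < q.-1)%N -> beats best c q.-1) ->
  forall q', (c < q' < n)%N -> beats best c q'.
Proof.
case/andP=> cq qn early cross bq bq1 q' /andP[cq' q'n] j E jn [E1 E2 E3 E4].
have [q'q|qq'|eq] := ltngtP q' q; last by rewrite eq in E2 E4; apply: (bq j).
  have cq1 : (c < q.-1)%N by lia.
  apply: (bq1 cq1 j E jn).
  have := @pos_mono q' q.-1 ltac:(lia) ltac:(lia) => h.
  by case: (early q.-1 ltac:(lia) j jn) => h2; split=> //; lra.
case: cross => [|[j' [h [[/andP[qj' j'n] h1 h2 _] hE]]]]; first lia.
apply: (bq j' E j'n); have := @pos_mono q.-1 q'.-1 ltac:(lia) ltac:(lia).
by split=> //; lra.
Qed.

End Metric.

(** * Reversal of the path, and augmented paths *)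

(* [s = 0] leaves the path as it is and [s = n.-1] reverses it. *)
Definition flip (s a : nat) : nat := (s - a + (a - s))%N.

Definition flip_dist (R : realType) (s : nat) (D : nat -> nat -> R) :
  nat -> nat -> R := fun a b => D (flip s a) (flip s b).

Section Flip.
Variables (R : realType) (n s : nat) (D : nat -> nat -> R).
Hypothesis s_end : s = 0%N \/ s = n.-1.

Lemma flip_lt a : (a < n)%N -> (flip s a < n)%N.
Proof. rewrite /flip; lia. Qed.

Lemma flipK a : (a < n)%N -> flip s (flip s a) = a.
Proof. rewrite /flip; lia. Qed.

Lemma flip_dist_metric : metric_below n D -> metric_below n (flip_dist s D).
Proof.
case=> D0 D_ge0 D_sym D_tri; split=> *; rewrite /flip_dist; do ?by
  [apply: D0; apply: flip_lt | apply: D_ge0; apply: flip_lt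
  |apply: D_sym; apply: flip_lt | apply: D_tri; apply: flip_lt].
Qed.

Lemma flip_dist_posB a b : metric_below n D -> (a < n)%N -> (b < n)%N ->
  `|pos (flip_dist s D) a - pos (flip_dist s D) b| =
  `|pos D (flip s a) - pos D (flip s b)|.
Proof.
case=> _ _ D_sym _; case: s_end => s_eq.
  have fE x : flip s x = x by rewrite /flip s_eq; lia.
  rewrite !fE => _ _; congr `|_ - _|; apply: eq_bigr => i _;
  by rewrite /flip_dist !fE.
(* On the reversed path, positions are measured from the other end. *)
have pE k : (k < n)%N -> pos (flip_dist s D) k = pos D n.-1 - pos D (flip s k).
  elim: k => [|k IHk] kn; first by rewrite pos0 /flip s_eq subn0 addn0 subrr.
  rewrite posS IHk 1?ltnW // /flip_dist.
  have -> : flip s k = (flip s k.+1).+1 by rewrite /flip; lia.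
  rewrite posS D_sym; [|rewrite /flip; lia|rewrite /flip; lia].
  lra.
by move=> an bn; rewrite !pE // distrC; congr `|_|; lra.
Qed.

Lemma reach_flip a b E : metric_below n D -> (a < n)%N -> (b < n)%N ->
  reach n (flip_dist s D) a b E <-> reach n D (flip s a) (flip s b) E.
Proof.
move=> D_metric an bn; split=> aE v vn.
  have vE := flipK vn; have := aE _ (flip_lt vn).
  by rewrite !flip_dist_posB ?flip_lt // vE.
by rewrite !flip_dist_posB //; apply: aE; apply: flip_lt.
Qed.

End Flip.

(** * Eccentricities in augmented paths *)

Section Augmentation.
Variables (R : realType) (n : nat) (d : 'I_n -> 'I_n -> R).
Hypothesis d_metric : is_metric d.

(** The metric on natural numbers, read off the oracle, with 0 as the default value outside the
    vertices. *)
Definition ndist (a b : nat) : R := odflt 0 (oracle d a b).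

Lemma oracleE a b : (a < n)%N -> (b < n)%N -> oracle d a b = Some (ndist a b).
Proof. by move=> an bn; rewrite /ndist /oracle /obind2 !insubT. Qed.

Lemma ndistE (i j : 'I_n) : ndist i j = d i j.
Proof. by rewrite /ndist /oracle /obind2 !valK. Qed.

Lemma ndist_metric : metric_below n ndist.
Proof.
case: d_metric => d0 d_ge0 d_sym d_tri; split.
- by move=> a an; rewrite (ndistE (Ordinal an) (Ordinal an)); apply/d0.
- by move=> a b an bn; rewrite (ndistE (Ordinal an) (Ordinal bn)).
- move=> a b an bn; rewrite (ndistE (Ordinal an) (Ordinal bn)) d_sym.
  by rewrite -ndistE.
move=> a b c an bn cn; have := d_tri (Ordinal an) (Ordinal bn) (Ordinal cn).
by rewrite -!ndistE.
Qed.

Local Notation X := (pos ndist).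

Lemma aug_edgeC (i j : 'I_n) : aug_edge i j = aug_edge j i.
Proof.
by apply/funext=> u; apply/funext=> v; rewrite /aug_edge; congr (_ || _); apply: orbC.
Qed.

Lemma path_edge_dist (u v : 'I_n) : path_edge u v -> d u v = `|X u - X v|.
Proof.
case: d_metric => _ d_ge0 d_sym _.
case/orP=> /eqP uv.
  rewrite -uv posS uv ndistE opprD addrA subrr add0r normrN ger0_norm //.
by rewrite -uv posS uv ndistE addrC addKr ger0_norm // d_sym.
Qed.

Lemma walk_line (e : rel 'I_n) (a b : 'I_n) : subrel (@path_edge n) e ->
  walk e d a b `|X a - X b|.
Proof.
move=> sub_e; have [k] := ubnP (maxn a b - minn a b)%N.
elim: k a b => // k IHk a b ltk.
have [ab|ba|/val_inj->] := ltngtP a b; last by apply: walk_refl.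
  have an : (a.+1 < n)%N by have := ltn_ord b; lia.
  have ae : path_edge a (Ordinal an) by rewrite /path_edge /= eqxx.
  apply: (walk_step (sub_e _ _ ae)); rewrite (path_edge_dist ae).
  have := IHk (Ordinal an) b; rewrite /= => /(_ ltac:(lia)).
  congr (walk _ _ _ _ _); have m1 := pos_mono ndist_metric (leqnSn a) an.
  have m2 := pos_mono ndist_metric ab (ltn_ord b).
  by rewrite !ler0_norm; lra.
have an : (a.-1 < n)%N by have := ltn_ord a; lia.
have ae : path_edge a (Ordinal an) by rewrite /path_edge /=; apply/orP; right; lia.
apply: (walk_step (sub_e _ _ ae)); rewrite (path_edge_dist ae).
have := IHk (Ordinal an) b; rewrite /= => /(_ ltac:(lia)).
congr (walk _ _ _ _ _).
have m1 := pos_mono ndist_metric (leq_pred a) (ltn_ord a).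
have m2 : X b <= X a.-1 by apply: (pos_mono ndist_metric) => //; lia.
by rewrite !ger0_norm; lra.
Qed.

Lemma path_sub_aug (i j : 'I_n) : subrel (@path_edge n) (aug_edge i j).
Proof. by move=> u v uv; rewrite /aug_edge uv. Qed.

Lemma ecc_le_reach (c j : 'I_n) E :
  reach n ndist c j E -> eccentricity (aug_edge c j) d c <= E.
Proof.
case: (d_metric) => _ d_ge0 d_sym _ cE; apply: ecc_le => v.
case: (cE v (ltn_ord v)); rewrite ?ndistE => h; apply: graph_dist_le => //.
  have [p [? ? le]] := @walk_line (aug_edge c j) c v (@path_sub_aug c j).
  by exists p; split=> //; apply: le_trans le _; rewrite distrC.
have [p [p1 p2 le]] := @walk_line (aug_edge c j) j v (@path_sub_aug c j).
apply: (@walk_step _ _ _ _ _ j); first by rewrite /aug_edge !eqxx orbT.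
by exists p; split=> //; lra.
Qed.

(* A shortest path tree rooted at [c] crosses the new edge in one direction
   only, say from [i] to [j], and then the edge from [c] to [j] is as good. *)
Lemma reach_ecc_aux (i j c : 'I_n) : (1 < n)%N ->
  `|X i - X c| <= `|X j - X c| + d i j ->
  exists2 j' : 'I_n, j' != c & reach n ndist c j' (eccentricity (aug_edge i j) d c).
Proof.
case: (d_metric) => d0 d_ge0 d_sym d_tri n_gt1 ij.
(* [Dj] and [phi] are the distances from [c] to [j] and to [v] when the new edge is traversed only
   from [i] to [j]. As a potential, [phi] bounds the true distances from below. *)
pose Dj : R := Num.min `|X j - X c| (`|X i - X c| + d i j).
pose phi (v : 'I_n) : R := Num.min `|X v - X c| (Dj + `|X j - X v|).
have Dj_le1 : Dj <= `|X j - X c| by rewrite ge_min lexx.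
have Dj_le2 : Dj <= `|X i - X c| + d i j by rewrite ge_min lexx orbT.
(* By hypothesis the edge gains nothing from [j] to [i]; this makes [phi] Lipschitz along the edge
   in that direction. *)
have Dj_ge : `|X i - X c| <= Dj + d i j.
  by rewrite /Dj minElt; case: ifP => _; have := d_ge0 i j; lra.
have Dj_ge0 : 0 <= Dj.
  by rewrite le_min normr_ge0 addr_ge0.
have phi1 v : phi v <= `|X v - X c| by rewrite ge_min lexx.
have phi2 v : phi v <= Dj + `|X j - X v| by rewrite ge_min lexx orbT.
have phi_ge (v : 'I_n) (l : R) : l <= `|X v - X c| -> l <= Dj + `|X j - X v| -> l <= phi v.
  by move=> h1 h2; rewrite le_min h1.
have phi_c : phi c = 0.
  apply/eqP; rewrite eq_le phi_ge ?subrr ?normr0 ?addr_ge0 // andbT.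
  by have := phi1 c; rewrite subrr normr0.
have phi_j : phi j <= Dj by have := phi2 j; rewrite subrr normr0 addr0.
have phi_lip a b : aug_edge i j a b -> phi b <= phi a + d a b.
  rewrite -lerBlDr => /or3P[ab | /andP[/eqP-> /eqP->] | /andP[/eqP-> /eqP->]].
  - rewrite (path_edge_dist ab); apply: phi_ge.
      have := phi1 b; have := ler_distD (X a) (X b) (X c).
      by rewrite (distrC (X b) (X a)); lra.
    by have := phi2 b; have := ler_distD (X a) (X j) (X b); lra.
  - apply: phi_ge; first by lra.
    by have := normr_ge0 (X j - X i); have := d_ge0 i j; lra.
  - rewrite d_sym; have := phi1 i => phi_i.
    by apply: phi_ge; have := normr_ge0 (X j - X j); lra.
have phi_ecc v : phi v <= eccentricity (aug_edge i j) d c.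
  apply: le_trans (graph_dist_le_ecc _ _ _ _).
  by apply: graph_dist_ge phi_lip => //; apply: walk_line; apply: path_sub_aug.
have c_dist (v : 'I_n) : d c v <= `|X v - X c|.
  by rewrite distrC -ndistE; apply: (dist_le_pos ndist_metric).
(* If [j] is [c] itself, [phi] is at least the distance along the path, and any other vertex may be
   taken for [j']. *)
have [jc|jc] := eqVneq j c; last first.
  exists j => // v vn; rewrite ndistE; have := phi_ecc (Ordinal vn).
  have Dcj : d c j <= Dj.
    rewrite le_min c_dist /=; apply: le_trans (d_tri c j i) _.
    by rewrite lerD2r.
  rewrite /phi minElt /=; case: ifP => _ h; [left=> // | right].
  lra.
have [j' j'c] : exists j' : 'I_n, j' != c.
  have [c0|c0] := eqVneq (c : nat) 0%N.
    by exists (Ordinal n_gt1); rewrite -val_eqE /= c0.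
  by exists (Ordinal (ltnW n_gt1)); rewrite -val_eqE /= eq_sym.
exists j' => // v vn; left; have := phi_ecc (Ordinal vn).
apply: le_trans; apply: phi_ge => //=.
by rewrite jc distrC; lra.
Qed.

(** The hypothesis of [reach_ecc_aux] holds for one of the two orientations of the edge. *)
Lemma reach_ecc (i j c : 'I_n) : (1 < n)%N ->
  exists2 j' : 'I_n, j' != c & reach n ndist c j' (eccentricity (aug_edge i j) d c).
Proof.
move=> n_gt1; have [ij|ij] := leP `|X i - X c| (`|X j - X c| + d i j).
  exact: reach_ecc_aux.
rewrite aug_edgeC; apply: reach_ecc_aux => //; case: (d_metric) => _ d_ge0 d_sym _.
by rewrite d_sym; have := d_ge0 i j; lra.
Qed.

(** Reduces optimality to edges starting at the center: by [reach_ecc] every eccentricity in every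
    augmented path is also achieved by such an edge. *)
Lemma optimal_of_reach (i j c : 'I_n) r : (i < j)%N ->
  eccentricity (aug_edge i j) d c <= r ->
  (forall (a b : 'I_n) E, a != b -> reach n ndist a b E -> r <= E) ->
  optimal_augmentation d i j c r.
Proof.
move=> ij ecc_r r_min.
have n_gt1 : (1 < n)%N by have := ltn_ord j; lia.
have r_le i' j' c' : r <= eccentricity (aug_edge i' j') d c'.
  have [b bc h] := reach_ecc i' j' c' n_gt1.
  by apply: r_min h; rewrite eq_sym.
have r_rad i' j' : r <= radius (aug_edge i' j') d by apply: radius_ge.
have rad_r : radius (aug_edge i j) d = r.
  by apply/eqP; rewrite eq_le r_rad (le_trans (radius_le_ecc _ _ c)).
split=> [//|i' j' _|u|//]; first by rewrite rad_r.
exact: le_trans ecc_r _.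
Qed.

End Augmentation.

(** * The program *)

Section Cost.
Variable m : nat.

(* The cost of a command all of whose loops are iterated at most [m] times. *)
Fixpoint cost_bound (c : cmd) : nat :=
  match c with
  | CSkip => 1
  | CIStore _ e1 e2 => (icost e1 + icost e2).+1
  | CRStore _ e1 e2 => (icost e1 + rcost e2).+1
  | CSeq c1 c2 => cost_bound c1 + cost_bound c2
  | CIf b c1 c2 => (bcost b + (cost_bound c1 + cost_bound c2)).+1
  | CWhile b c1 => m.+1 * (bcost b + cost_bound c1).+1
  end%N.

Variables (R : realType) (n : nat) (d : 'I_n -> 'I_n -> R) (W : nat).

(** Used as a weakest precondition: the rules below execute a command symbolically, with [Q] as
    continuation. *)
Definition runs (c : cmd) (s : store R) (Q : store R -> Prop) : Prop :=
  exists t s', [/\ exec d W c s t s', (t <= cost_bound c)%N & Q s'].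

Lemma runs_skip s (Q : store R -> Prop) : Q s -> runs CSkip s Q.
Proof. by exists 1%N, s; split=> //; constructor. Qed.

Lemma runs_seti i x s a e1 e2 (Q : store R -> Prop) :
  ieval W s e1 = Some i -> ieval W s e2 = Some x ->
  Q (store_int s a i x) -> runs (CIStore a e1 e2) s Q.
Proof. by move=> h1 h2 h; do 2!eexists; split; [constructor; eauto | | eauto]. Qed.

Lemma runs_setr i x s a e1 e2 (Q : store R -> Prop) :
  ieval W s e1 = Some i -> reval d W s e2 = Some x ->
  Q (store_real s a i x) -> runs (CRStore a e1 e2) s Q.
Proof. by move=> h1 h2 h; do 2!eexists; split; [constructor; eauto | | eauto]. Qed.

Lemma runs_seq s c1 c2 Q :
  runs c1 s (fun s1 => runs c2 s1 Q) -> runs (CSeq c1 c2) s Q.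
Proof.
case=> t1 [s1 [h1 le1 [t2 [s2 [h2 le2 q]]]]].
exists (t1 + t2)%N, s2; split=> //=; last exact: leq_add.
exact: ExecSeq h1 h2.
Qed.

Lemma runs_if v s b c1 c2 Q :
  beval d W s b = Some v -> runs (if v then c1 else c2) s Q ->
  runs (CIf b c1 c2) s Q.
Proof.
move=> hb [t [s1 [h le q]]]; exists (bcost b + t).+1, s1; split=> //=.
  exact: ExecIf hb h.
by case: v {hb h} le => le; lia.
Qed.

(** The index of the invariant is a strictly decreasing variant, so there are at most [k]
    iterations; the successor in the bound pays for the final test. *)
Lemma runs_while (I : nat -> store R -> Prop) (Q : store R -> Prop) b c k s :
  (k <= m)%N -> I k s ->
  (forall k s, I k s -> exists2 v, beval d W s b = Some v &
     if v then runs c s (fun s' => exists2 k', (k' < k)%N & I k' s') else Q s) ->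
  runs (CWhile b c) s Q.
Proof.
move=> km Iks step.
suff [t [s' [h le q]]] : exists t s', [/\ exec d W (CWhile b c) s t s',
    (t <= k.+1 * (bcost b + cost_bound c).+1)%N & Q s'].
  by exists t, s'; split=> //=; apply: leq_trans le _; rewrite leq_mul2r ltnS km orbT.
elim/ltn_ind: k s Iks {km} => k IHk s /step[v hb].
case: v hb => hb; last first.
  by exists (bcost b).+1, s; split=> //; [constructor | lia].
case=> t1 [s1 [h1 le1 [k' k'k /(IHk _ k'k)[t2 [s2 [h2 le2 q]]]]]].
exists (bcost b + t1 + t2).+1, s2; split=> //; first exact: ExecWhileTrue hb h1 h2.
suff : (k'.+1 * (bcost b + cost_bound c).+1 <= k * (bcost b + cost_bound c).+1)%N.
  by rewrite (mulSn k); lia.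
by rewrite leq_mul2r k'k orbT.
Qed.

End Cost.
Arguments runs_seti {m R n d W} i x {s a e1 e2 Q}.
Arguments runs_setr {m R n d W} i x {s a e1 e2 Q}.

(** * The code of the algorithm *)

Local Notation "c1 ;; c2" := (CSeq c1 c2) (at level 61, right associativity).

Definition ivar (a : nat) : iexp := ILoad a (INum 0).
Definition rvar (a : nat) : rexp := RLoad a (INum 0).
Definition set_ivar (a : nat) (e : iexp) : cmd := CIStore a (INum 0) e.
Definition set_rvar (a : nat) (e : rexp) : cmd := CRStore a (INum 0) e.
Definition succ_exp (e : iexp) : iexp := IOp IAdd e (INum 1).
Definition pred_exp (e : iexp) : iexp := IOp ISub e (INum 1).
Definition add_exp (e1 e2 : rexp) : rexp := ROp RAdd e1 e2.
Definition sub_exp (e1 e2 : rexp) : rexp := ROp RSub e1 e2.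

(* Array 4 holds, for every split, the last vertex before the midpoint; real
   array 1 holds the positions along the path.  The cells 0 of the arrays are
   variables: the flip of the current pass in 1, the center in 2, the advancing
   split in 3, the endpoint of the jump in 5, the split under evaluation in 6,
   and its cost in the real array 2. *)
Definition size_exp : iexp := ivar 0.
Definition last_exp : iexp := pred_exp size_exp.
Definition side : iexp := ivar 1.
Definition ctr : iexp := ivar 2.
Definition ptr : iexp := ivar 3.
Definition jump : iexp := ivar 5.
Definition split_at : iexp := ivar 6.
Definition best : rexp := rvar 0.
Definition cost : rexp := rvar 2.
Definition pos_exp (e : iexp) : rexp := RLoad 1 e.
Definition mid_exp (e : iexp) : iexp := ILoad 4 e.
Definition flip_exp (e : iexp) : iexp :=
  IOp IAdd (IOp ISub side e) (IOp ISub e side).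
Definition dist_exp (e1 e2 : iexp) : rexp := RDist (flip_exp e1) (flip_exp e2).

Definition compute_pos : cmd :=
  set_ivar 2 (INum 0);; set_rvar 1 (RNum 0);;
  CWhile (BIlt (succ_exp ctr) size_exp)
    (CRStore 1 (succ_exp ctr)
       (add_exp (pos_exp ctr) (dist_exp ctr (succ_exp ctr)));;
     set_ivar 2 (succ_exp ctr)).

(** Two pointers in one loop: each iteration advances either the midpoint, in [ptr], or the split,
    in [ctr]. *)
Definition compute_mid : cmd :=
  set_ivar 2 (INum 0);; set_ivar 3 (INum 0);;
  CWhile (BIlt ctr size_exp)
    (CIf (BAnd (BIlt (succ_exp ptr) size_exp)
            (BNot (BRlt (add_exp (pos_exp ctr) (pos_exp last_exp))
                     (add_exp (pos_exp (succ_exp ptr)) (pos_exp (succ_exp ptr))))))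
       (set_ivar 3 (succ_exp ptr))
       (CIStore 4 ctr ptr;; set_ivar 2 (succ_exp ctr))).

Definition find_jump : cmd :=
  set_ivar 5 (mid_exp split_at);;
  set_rvar 2 (add_exp (dist_exp ctr jump)
                (sub_exp (pos_exp last_exp) (pos_exp jump)));;
  CIf (BIlt (succ_exp jump) size_exp)
    (CIf (BRlt (add_exp (dist_exp ctr (succ_exp jump))
                  (sub_exp (pos_exp (succ_exp jump)) (pos_exp split_at))) cost)
       (set_rvar 2 (add_exp (dist_exp ctr (succ_exp jump))
                      (sub_exp (pos_exp (succ_exp jump)) (pos_exp split_at)));;
        set_ivar 5 (succ_exp jump))
       CSkip)
    CSkip.

Definition raise_cost (e : rexp) : cmd :=
  CIf (BRlt cost e) (set_rvar 2 e) CSkip.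

Definition save_edge (e1 e2 : iexp) : cmd :=
  CIStore 0 (INum 1) e1;; CIStore 0 (INum 2) e2.

Definition update_best : cmd :=
  raise_cost (pos_exp ctr);;
  raise_cost (sub_exp (pos_exp (pred_exp split_at)) (pos_exp ctr));;
  CIf (BRlt cost best)
    (set_rvar 0 cost;; CIStore 0 (INum 3) (flip_exp ctr);;
     CIf (BIlt (flip_exp ctr) (flip_exp jump))
       (save_edge (flip_exp ctr) (flip_exp jump))
       (save_edge (flip_exp jump) (flip_exp ctr)))
    CSkip.

(** Each iteration advances either the split, while it is early, or the center, after trying the
    splits [ptr] and [ptr - 1]. The last test keeps the split beyond the center. *)
Definition search : cmd :=
  set_ivar 2 (INum 0);; set_ivar 3 (INum 1);;
  CWhile (BIlt (succ_exp ctr) size_exp)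
    (set_ivar 6 ptr;; find_jump;;
     CIf (BAnd (BIlt (succ_exp ptr) size_exp)
            (BRlt (sub_exp (pos_exp (pred_exp ptr)) (pos_exp ctr)) cost))
       (set_ivar 3 (succ_exp ptr))
       (update_best;;
        CIf (BIlt (succ_exp ctr) ptr)
          (set_ivar 6 (pred_exp ptr);; find_jump;; update_best) CSkip;;
        set_ivar 2 (succ_exp ctr);;
        CIf (BIlt ctr ptr) CSkip (set_ivar 3 (succ_exp ptr)))).

(** The initial solution is the path itself with its first vertex as center, at cost [L]. The second
    pass treats the reversed path and keeps the best solution so far. *)
Definition augment_path : cmd :=
  set_ivar 1 (INum 0);; compute_pos;;
  set_rvar 0 (pos_exp last_exp);; CIStore 0 (INum 3) (INum 0);;
  save_edge (INum 0) (INum 1);;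
  compute_mid;; search;;
  set_ivar 1 last_exp;; compute_pos;; compute_mid;; search.

Section Program.
Variables (R : realType) (n : nat) (d : 'I_n -> 'I_n -> R).
Hypotheses (n_gt1 : (1 < n)%N) (d_metric : is_metric d).

Local Notation W := (n ^ 2)%N.
Local Notation runs := (runs (n + n) d W).

(** * Values of expressions *)

Section Expressions.
Variables (s : store R) (sd : nat).

(** As [n] is at least 2, [n ^ 2] is at least 4 and exceeds [n]: this covers the integer constants
    of the program and all its indices. *)
Lemma wordE x : (x < 4)%N || (x <= n)%N -> word W x = Some x.
Proof. by move=> h; rewrite /word; case: ltnP => //; nia. Qed.

Lemma ieval_num k : (k < 4)%N -> ieval W s (INum k) = Some k.
Proof. by move=> k4; rewrite /= wordE ?k4. Qed.

Lemma ieval_load a e i x : ieval W s e = Some i -> ints s a i = x ->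
  ieval W s (ILoad a e) = Some x.
Proof. by move=> /= -> <-. Qed.

Lemma ieval_var a x : ints s a 0 = x -> ieval W s (ivar a) = Some x.
Proof. by apply: ieval_load; apply: ieval_num. Qed.

Lemma ieval_succ e x : ieval W s e = Some x -> (x < n)%N ->
  ieval W s (succ_exp e) = Some x.+1.
Proof. by move=> /= -> xn; rewrite wordE //= addn1 wordE ?xn ?orbT. Qed.

Lemma ieval_pred e x : ieval W s e = Some x -> (x <= n)%N ->
  ieval W s (pred_exp e) = Some x.-1.
Proof. by move=> /= -> xn; rewrite wordE //= subn1 wordE //; lia. Qed.

Lemma ieval_flip e x : ints s 1 0 = sd -> (sd < n)%N ->
  ieval W s e = Some x -> (x < n)%N -> ieval W s (flip_exp e) = Some (flip sd x).
Proof.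
move=> hs sn he xn; have hside : ieval W s side = Some sd by apply: ieval_var.
have op o e1 e2 a b : ieval W s e1 = Some a -> ieval W s e2 = Some b ->
    ieval W s (IOp o e1 e2) = apply_iop W o a b by move=> /= -> ->.
rewrite /flip /flip_exp; apply: etrans (op _ _ _ _ _ _ _) _.
- by rewrite (op _ _ _ _ _ hside he) /= wordE //; lia.
- by rewrite (op _ _ _ _ _ he hside) /= wordE //; lia.
by rewrite /= wordE //; lia.
Qed.

Lemma reval_load a e i x : ieval W s e = Some i -> reals s a i = x ->
  reval d W s (RLoad a e) = Some x.
Proof. by move=> /= -> <-. Qed.

Lemma reval_var a x : reals s a 0 = x -> reval d W s (rvar a) = Some x.
Proof. by apply: reval_load; apply: ieval_num. Qed.

Lemma reval_dist e1 e2 x y : ints s 1 0 = sd -> sd = 0%N \/ sd = n.-1 ->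
  ieval W s e1 = Some x -> ieval W s e2 = Some y -> (x < n)%N -> (y < n)%N ->
  reval d W s (dist_exp e1 e2) = Some (flip_dist sd (ndist d) x y).
Proof.
move=> hs sE h1 h2 xn yn; have sn : (sd < n)%N by lia.
rewrite /dist_exp /reval (ieval_flip hs sn h1 xn) (ieval_flip hs sn h2 yn) /=.
by rewrite oracleE ?flip_lt.
Qed.

Lemma reval_add e1 e2 x y : reval d W s e1 = Some x -> reval d W s e2 = Some y ->
  reval d W s (add_exp e1 e2) = Some (x + y).
Proof. by move=> /= -> ->. Qed.

Lemma reval_sub e1 e2 x y : reval d W s e1 = Some x -> reval d W s e2 = Some y ->
  reval d W s (sub_exp e1 e2) = Some (x - y).
Proof. by move=> /= -> ->. Qed.

Lemma beval_ilt e1 e2 x y : ieval W s e1 = Some x -> ieval W s e2 = Some y ->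
  beval d W s (BIlt e1 e2) = Some (x < y)%N.
Proof. by move=> /= -> ->. Qed.

Lemma beval_rlt e1 e2 x y : reval d W s e1 = Some x -> reval d W s e2 = Some y ->
  beval d W s (BRlt e1 e2) = Some (x < y).
Proof. by move=> /= -> ->. Qed.

Lemma beval_not b v : beval d W s b = Some v ->
  beval d W s (BNot b) = Some (~~ v).
Proof. by move=> /= ->. Qed.

Lemma beval_and b1 b2 v1 v2 :
  beval d W s b1 = Some v1 -> beval d W s b2 = Some v2 ->
  beval d W s (BAnd b1 b2) = Some (v1 && v2).
Proof. by move=> /= -> ->. Qed.

End Expressions.

(** * Correctness of one pass, on the path or on its reversal *)

Section Side.
Variable sd : nat.
Hypothesis sd_end : sd = 0%N \/ sd = n.-1.

Local Notation D := (flip_dist sd (ndist d)).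
Local Notation X := (pos D).
Local Notation L := (X n.-1).

Let D_metric : metric_below n D.
Proof. exact: flip_dist_metric (ndist_metric d_metric). Qed.

Definition same_output (s s' : store R) : Prop :=
  [/\ ints s' 0 = ints s 0, ints s' 1 = ints s 1 & reals s' 0 = reals s 0].

Definition pos_stored (s : store R) : Prop :=
  forall k, (k < n)%N -> reals s 1 k = X k.

Definition mid_stored (s : store R) : Prop :=
  forall k, (k < n)%N -> midpoint n D k (ints s 4 k).

Ltac evaluate_side := first [lia | eassumption | by []].

Ltac evaluate :=
  lazymatch goal with
  | |- ieval _ _ (INum _) = _ => apply: ieval_num; by []
  | |- ieval _ _ (succ_exp _) = _ => eapply ieval_succ; [evaluate | evaluate_side]
  | |- ieval _ _ (pred_exp _) = _ => eapply ieval_pred; [evaluate | evaluate_side]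
  | |- ieval _ _ last_exp = _ => eapply ieval_pred; [evaluate | evaluate_side]
  | |- ieval _ _ (flip_exp _) = _ =>
      eapply ieval_flip; [eassumption | evaluate_side | evaluate | evaluate_side]
  | |- ieval _ _ (mid_exp _) = _ => eapply ieval_load; [evaluate | reflexivity]
  | |- ieval _ _ _ = _ => eapply ieval_var; first [eassumption | reflexivity]
  | |- reval _ _ _ (RNum _) = _ => reflexivity
  | |- reval _ _ _ (add_exp _ _) = _ => eapply reval_add; evaluate
  | |- reval _ _ _ (sub_exp _ _) = _ => eapply reval_sub; evaluate
  | |- reval _ _ _ (dist_exp _ _) = _ =>
      eapply reval_dist; [eassumption | eassumption | evaluate | evaluate | evaluate_side | evaluate_side]
  | |- reval _ _ _ (pos_exp _) = _ =>
      eapply reval_load; [evaluate |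
        match goal with
        | H : context [reals _ 1 _ = _] |- _ => eapply H; evaluate_side
        | H : pos_stored _ |- _ => eapply H; evaluate_side
        end]
  | |- reval _ _ _ _ = _ => eapply reval_var; first [eassumption | reflexivity]
  | |- beval _ _ _ (BIlt _ _) = _ => eapply beval_ilt; evaluate
  | |- beval _ _ _ (BRlt _ _) = _ => eapply beval_rlt; evaluate
  | |- beval _ _ _ (BNot _) = _ => eapply beval_not; evaluate
  | |- beval _ _ _ (BAnd _ _) = _ => eapply beval_and; evaluate
  end.

Lemma runs_compute_pos s Q : ints s 0 0 = n -> ints s 1 0 = sd ->
  (forall s', same_output s s' -> pos_stored s' -> Q s') ->
  runs compute_pos s Q.
Proof.
move=> size_s side_s HQ.
apply: runs_seq; apply: (runs_seti 0 0); [evaluate | evaluate |].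
apply: runs_seq; apply: (runs_setr 0 0); [evaluate | evaluate |].
pose I k s' := same_output s s' /\ exists c,
  [/\ ints s' 2 0 = c, (c < n)%N, k = (n - c)%N &
      forall i, (i <= c)%N -> reals s' 1 i = X i].
apply: (runs_while (I := I) (k := n)); first exact: leq_addr.
  split; first by [].
  exists 0%N; split=> //; [lia | lia |].
  by move=> i; rewrite leqn0 => /eqP->; rewrite pos0.
move=> k s1 [[out1 out2 out3] [c [ctr_s1 cn kE pos_s1]]].
have size_s1 : ints s1 0 0 = n by rewrite out1.
have side_s1 : ints s1 1 0 = sd by rewrite out2.
eexists; first by evaluate.
case: ltnP => [c1n|nc1]; last first.
  by apply: HQ => // i i_lt; apply: pos_s1; lia.
apply: runs_seq; apply: (runs_setr c.+1 (X c.+1)); first evaluate.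
  rewrite posS; evaluate.
apply: (runs_seti 0 c.+1); [evaluate | evaluate |].
exists (n - c.+1)%N; first lia.
split=> //; exists c.+1; split=> // i ic /=.
rewrite /update /=; case: eqP => [->//|ne]; apply: pos_s1; lia.
Qed.

Lemma runs_compute_mid s Q : ints s 0 0 = n -> pos_stored s ->
  (forall s', same_output s s' -> pos_stored s' -> mid_stored s' -> Q s') ->
  runs compute_mid s Q.
Proof.
move=> size_s pos_s HQ.
apply: runs_seq; apply: (runs_seti 0 0); [evaluate | evaluate |].
apply: runs_seq; apply: (runs_seti 0 0); [evaluate | evaluate |].
(* [p] never passes the midpoint for the current split [c]; the variant counts the moves left to
   both pointers. *)
pose I k s' := [/\ same_output s s', pos_stored s' & exists c p,
  [/\ ints s' 2 0 = c, ints s' 3 0 = p, (c <= n)%N && (p < n)%N, k = (n - c + (n - p))%N &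
      [/\ (c < n)%N -> X p + X p <= X c + L &
      forall i, (i < c)%N -> midpoint n D i (ints s' 4 i)]]].
have L_ge k : (k < n)%N -> X k <= L by move=> kn; apply: (pos_mono D_metric); lia.
apply: (runs_while (I := I) (k := n + n)); first exact: leqnn.
  split=> //; exists 0%N, 0%N; split=> //; [lia | lia | split=> //].
  by move=> _; rewrite pos0; have := L_ge 0%N ltac:(lia); rewrite pos0; lra.
move=> k s1 [[out1 out2 out3] pos_s1 [c [p [ctr_s1 ptr_s1 /andP[cn pn] kE [pL mid_s1]]]]].
have size_s1 : ints s1 0 0 = n by rewrite out1.
eexists; first by evaluate.
case: ltnP => [c_lt|nc]; last by apply: HQ => // i i_lt; apply: mid_s1; lia.
(* Conjunction evaluates both sides, so cell [p.+1] is read even when it is not a position; its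
   content stays abstract until [p.+1 < n] is known. *)
have guard : beval d W s1 (BAnd (BIlt (succ_exp ptr) size_exp)
    (BNot (BRlt (add_exp (pos_exp ctr) (pos_exp last_exp))
      (add_exp (pos_exp (succ_exp ptr)) (pos_exp (succ_exp ptr)))))) =
    Some ((p.+1 < n)%N && ~~ (X c + L < reals s1 1 p.+1 + reals s1 1 p.+1)).
  apply: beval_and; first by evaluate.
  apply: beval_not; apply: beval_rlt; first evaluate.
  by apply: reval_add; eapply reval_load; [evaluate | reflexivity | evaluate | reflexivity].
apply: (runs_if guard); case: ifP => [/andP[p1n]|].
  rewrite pos_s1 // -leNgt => p1L.
  apply: (runs_seti 0 p.+1); [evaluate | evaluate |].
  exists (n - c + (n - p.+1))%N; first lia.
  by split=> //; exists c, p.+1; split=> //; rewrite cn.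
move=> stop.
have {}stop : (p.+1 < n)%N -> X c + L < X p.+1 + X p.+1.
  by move=> p1n; move: stop; rewrite p1n pos_s1 //= => /negbFE.
(* Otherwise [p.+1] would be at most [c], hence not beyond the midpoint, and [p] could still
   advance. *)
have cp : (c <= p)%N.
  rewrite leqNgt; apply/negP=> pc; have p1n : (p.+1 < n)%N by lia.
  have := stop p1n; have := L_ge _ p1n.
  by have := pos_mono D_metric pc c_lt; lra.
apply: runs_seq; apply: (runs_seti c p); [evaluate | evaluate |].
apply: (runs_seti 0 c.+1); [evaluate | evaluate |].
exists (n - c.+1 + (n - p))%N; first lia.
split=> //; exists c.+1, p; split=> //; first by rewrite c_lt.
split=> [c1n|i ic].
  by have := pos_mono D_metric (leqnSn c) c1n; have := pL c_lt; lra.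
rewrite /= /update /=; case: eqP => [->|ne]; last by apply: mid_s1; lia.
by split=> //; [rewrite cp | apply: pL].
Qed.

(** Only the upper bound: the recorded radius is achieved. That nothing is better is shown by the
    searches. *)
Definition saved (s : store R) : Prop :=
  exists i j c : 'I_n, [/\ ints s 0 1 = i, ints s 0 2 = j, ints s 0 3 = c,
    (i < j)%N & eccentricity (aug_edge i j) d c <= reals s 0 0].

Definition state (c p q : nat) (b : R) (s : store R) : Prop :=
  [/\ [/\ ints s 0 0 = n, ints s 1 0 = sd, pos_stored s, mid_stored s & saved s],
      ints s 2 0 = c, ints s 3 0 = p, ints s 6 0 = q & reals s 0 0 = b].

Lemma runs_find_jump c p q b s Q : (c < n)%N -> (q < n)%N -> state c p q b s ->
  (forall s', state c p q b s' ->
     best_jump n D c q (ints s' 5 0) (reals s' 2 0) -> Q s') ->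
  runs find_jump s Q.
Proof.
move=> cn qn st HQ.
case: (st) => -[size_s side_s pos_s mid_s saved_s] ctr_s ptr_s q_s b_s.
have qmid := mid_s q qn; set r := ints s 4 q in qmid.
have [/andP[qr rn] _ _] := qmid.
apply: runs_seq; apply: (runs_seti 0 r); first evaluate.
  by apply: ieval_load; [evaluate | ].
set s1 := store_int _ _ _ _.
have jump1 : ints s1 5 0 = r by [].
apply: runs_seq; apply: (runs_setr 0 (D c r + (L - X r))); [evaluate | evaluate |].
set s2 := store_real _ _ _ _.
have jump2 : ints s2 5 0 = r by [].
have cost2 : reals s2 2 0 = D c r + (L - X r) by [].
have st2 : state c p q b s2 by [].
apply: runs_if; first evaluate.
have best2 := best_jump_midpoint D_metric cn qmid.
case: ltnP => [rn1|nr1]; last first.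
  by apply: runs_skip; apply: HQ => //; apply: best2; lia.
apply: runs_if; first by evaluate.
case: ltP => [lt|ge]; last first.
  by apply: runs_skip; apply: HQ => //; apply: best2.
apply: runs_seq; apply: (runs_setr 0 (D c r.+1 + (X r.+1 - X q))); [evaluate | evaluate |].
apply: (runs_seti 0 r.+1); [evaluate | evaluate |].
by apply: HQ => //; apply: (best_jump_midpointS D_metric cn qmid rn1); apply: ltW.
Qed.

(** The conditional acts as one assignment of the maximum: skipping equals storing the old value
    again, by extensionality of stores. *)
Lemma runs_raise_cost e x s Q : reval d W s e = Some x ->
  Q (store_real s 2 0 (Num.max (reals s 2 0) x)) -> runs (raise_cost e) s Q.
Proof.
move=> ex HQ; apply: runs_if.
  by apply: beval_rlt ex; apply: reval_var; reflexivity.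
rewrite maxElt in HQ; case: ifP HQ => _ HQ.
  by apply: (runs_setr 0 x) => //; evaluate.
apply: runs_skip; suff <- : store_real s 2 0 (reals s 2 0) = s by [].
case: s {ex HQ} => iarr rarr; congr Store.
apply/funext=> a; apply/funext=> i; rewrite /update.
by case: ifP => // /andP[/eqP-> /eqP->].
Qed.

Lemma runs_update_best c p q b s Q : (c < q < n)%N -> state c p q b s ->
  best_jump n D c q (ints s 5 0) (reals s 2 0) ->
  (forall s' b', state c p q b' s' -> b' <= b -> beats n D b' c q -> Q s') ->
  runs update_best s Q.
Proof.
case/andP=> cq qn st; set j := ints s 5 0; set h := reals s 2 0.
move=> [/andP[qj jn] h1 h2 h_min] HQ.
case: (st) => -[size_s side_s pos_s mid_s saved_s] ctr_s ptr_s q_s b_s.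
have jump_s : ints s 5 0 = j by [].
apply: runs_seq; apply: (@runs_raise_cost _ (X c)); first by evaluate.
set s1 := store_real _ _ _ _; have jump_s1 : ints s1 5 0 = j by [].
have st1 : state c p q b s1 by [].
apply: runs_seq; apply: (@runs_raise_cost _ (X q.-1 - X c)); first by evaluate.
set s2 := store_real _ _ _ _; have jump_s2 : ints s2 5 0 = j by [].
have st2 : state c p q b s2 by [].
set x := reals s2 2 0.
have x_def : x = Num.max (Num.max h (X c)) (X q.-1 - X c) by [].
have le_x : split_cost_le n D c q j x.
  have : h <= x by rewrite x_def !le_max lexx.
  have : X c <= x by rewrite x_def !le_max lexx orbT.
  have : X q.-1 - X c <= x by rewrite x_def !le_max lexx orbT.
  by split=> //; lra.
have x_min : beats n D x c q.
  move=> j' E j'n [E1 E2 E3 E4]; rewrite x_def !ge_max E1 E2 !andbT.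
  by case: (h_min j' j'n) => h'; lra.
apply: runs_if; first by evaluate.
case: ltP => [xb|bx]; last first.
  by apply: runs_skip; apply: (HQ _ b) => //; apply: beats_le x_min.
have cn : (c < n)%N by lia.
(* The result is recorded in the numbering of the original path, so the bound is carried back
   through the reversal. *)
have fcj : reach n (ndist d) (flip sd c) (flip sd j) x.
  apply/(reach_flip sd_end) => //; first exact: ndist_metric.
  by apply: (reach_of_split D_metric) le_x; rewrite ?cq.
have fcn := flip_lt sd_end cn; have fjn := flip_lt sd_end jn.
have ecc := @ecc_le_reach _ _ _ d_metric (Ordinal fcn) (Ordinal fjn) _ fcj.
apply: runs_seq; apply: (runs_setr 0 x); [evaluate | by evaluate |].
apply: runs_seq; apply: (runs_seti 3 (flip sd c)); [evaluate | evaluate |].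
apply: runs_if; first evaluate.
case: ltnP => [lt|ge]; apply: runs_seq.
- apply: (runs_seti 1 (flip sd c)); [evaluate | evaluate |].
  apply: (runs_seti 2 (flip sd j)); [evaluate | evaluate |].
  apply: (HQ _ x) => //; last exact: ltW.
  by split=> //; split=> //; exists (Ordinal fcn), (Ordinal fjn), (Ordinal fcn).
apply: (runs_seti 1 (flip sd j)); [evaluate | evaluate |].
apply: (runs_seti 2 (flip sd c)); [evaluate | evaluate |].
apply: (HQ _ x) => //; last exact: ltW.
split=> //; split=> //; exists (Ordinal fjn), (Ordinal fcn), (Ordinal fcn).
split=> //=; last by rewrite aug_edgeC.
(* The endpoints stay distinct since [c < q <= j] and [flip] is injective on vertices. *)
by rewrite ltn_neqAle ge andbT; move: cq qj ge {ecc fcj}; rewrite /flip; lia.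
Qed.

Lemma runs_search s Q :
  ints s 0 0 = n -> ints s 1 0 = sd -> pos_stored s -> mid_stored s -> saved s ->
  (forall s', ints s' 0 0 = n -> saved s' -> reals s' 0 0 <= reals s 0 0 ->
     (forall c j E, (c < j < n)%N -> reach n D c j E -> reals s' 0 0 <= E) ->
     Q s') ->
  runs search s Q.
Proof.
move=> size_s side_s pos_s mid_s saved_s HQ.
apply: runs_seq; apply: (runs_seti 0 0); [evaluate | evaluate |].
apply: runs_seq; apply: (runs_seti 0 1); [evaluate | evaluate |].
(* Centers before [c] are settled, and the splits between [c] and [p] are early. [p] may equal [n]
   once [c] is the last vertex. *)
pose I k s' := exists c p b,
  [/\ exists q, state c p q b s', [/\ (c < p)%N, (c < n)%N & (c.+1 < n -> p < n)%N],
      k = (n - c + (n - p))%N, b <= reals s 0 0 &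
      (forall c' q, (c' < c)%N -> (c' < q < n)%N -> beats n D b c' q) /\
      (forall q, (c < q < p)%N -> split_early n D c q)].
apply: (runs_while (I := I) (k := (n + n.-1)%N)); first lia.
  exists 0%N, 1%N, (reals s 0 0); split=> //.
  - by exists (ints s 6 0).
  - by split=> //; lia.
  - by lia.
  - by split=> // q; lia.
move=> k s1 [c [p [b [[q0 st1] [cp cn pn] kE b_le [done early]]]]].
case: (st1) => -[size_s1 side_s1 pos_s1 mid_s1 saved_s1] ctr_s1 ptr_s1 q_s1 b_s1.
eexists; first by evaluate.
case: ltnP => [c1n|nc1]; last first.
  (* Here [c] is the last vertex, so every center with a vertex after it is settled. *)
  apply: HQ => //; rewrite ?b_s1 // => c' j E /(split_of_reach D_metric) h.
  by move=> /h [q [j' [/andP[c'q qn] j'n]]]; apply: done; lia.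
have {}pn := pn c1n.
apply: runs_seq; apply: (runs_seti 0 p); [evaluate | evaluate |].
set s2 := store_int _ _ _ _; have st2 : state c p p b s2 by [].
apply: runs_seq; apply: (runs_find_jump cn pn st2) => s3 st3 best3.
case: (st3) => -[size_s3 side_s3 pos_s3 mid_s3 saved_s3] ctr_s3 ptr_s3 q_s3 b_s3.
apply: runs_if; first by evaluate.
case: ifP => [/andP[p1n lt]|stop].
  apply: (runs_seti 0 p.+1); [evaluate | evaluate |].
  exists (n - c + (n - p.+1))%N; first lia.
  exists c, p.+1, b; split=> //; first by exists p.
    by split=> //; lia.
  split=> // q /andP[cq]; rewrite ltnS leq_eqVlt => /predU1P[->|qp].
    case: best3 => _ _ _ h_min j' j'n.
    by case: (h_min j' j'n) => h'; [left | right]; apply: lt_le_trans lt _.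
  by apply: early; rewrite cq.
(* The pointer stops at the last split or at the crossing, as [beats_all] requires. *)
have cross : p.+1 = n \/ exists j h, best_jump n D c p j h /\ h <= X p.-1 - X c.
  move/negbT: stop; rewrite negb_and -leqNgt -leNgt => /orP[np|ge].
    by left; lia.
  by right; exists (ints s3 5 0), (reals s3 2 0).
have cpn : (c < p < n)%N by rewrite cp.
apply: runs_seq; apply: (runs_update_best cpn st3 best3) => s4 b4 st4 b4_le beats4.
apply: runs_seq.
(* The common end of both branches: the center advances, whether or not [p.-1] had to be tried. *)
suff next s5 b5 q5 : state c p q5 b5 s5 -> b5 <= b4 ->
    ((c < p.-1)%N -> beats n D b5 c p.-1) ->
    runs (set_ivar 2 (succ_exp ctr);;
          CIf (BIlt ctr ptr) CSkip (set_ivar 3 (succ_exp ptr))) s5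
      (fun s' => exists2 k', (k' < k)%N & I k' s').
  case: (st4) => -[size_s4 side_s4 pos_s4 mid_s4 saved_s4] ctr_s4 ptr_s4 q_s4 b_s4.
  apply: runs_if; first by evaluate.
  case: ltnP => [c1p|pc1]; last first.
    by apply: runs_skip; apply: (next _ b4) => //; lia.
  have p1n : (p.-1 < n)%N by lia.
  apply: runs_seq; apply: (runs_seti 0 p.-1); [evaluate | evaluate |].
  set s5 := store_int _ _ _ _; have st5 : state c p p.-1 b4 s5 by [].
  apply: runs_seq; apply: (runs_find_jump cn p1n st5) => s6 st6 best6.
  have cp1n : (c < p.-1 < n)%N by lia.
  by apply: (runs_update_best cp1n st6 best6) => s7 b7 st7 b7_le beats7; apply: (next _ b7) st7 _ _.
move=> st5 b5_le beats5.
have {beats4}beats4 : beats n D b5 c p by apply: beats_le beats4.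
have all5 := beats_all D_metric cpn early cross beats4 beats5.
case: st5 => -[size_s5 side_s5 pos_s5 mid_s5 saved_s5] ctr_s5 ptr_s5 q_s5 b_s5.
apply: runs_seq; apply: (runs_seti 0 c.+1); [evaluate | evaluate |].
have done' c' q : (c' < c.+1)%N -> (c' < q < n)%N -> beats n D b5 c' q.
  rewrite ltnS leq_eqVlt => /predU1P[->|c'c]; first exact: all5.
  by move=> c'q; apply: beats_le (done _ _ c'c c'q); lra.
have early' q : (c.+1 < q < p)%N -> split_early n D c.+1 q.
  by move=> /andP[cq qp]; apply: (split_early_step D_metric (leqnSn c) c1n); apply: early; lia.
set s6 := store_int _ _ _ _.
have ctr_s6 : ints s6 2 0 = c.+1 by [].
apply: runs_if; first evaluate.
case: ltnP => [c1p|pc1].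
  apply: runs_skip; exists (n - c.+1 + (n - p))%N; first lia.
  exists c.+1, p, b5; split=> //; [by exists q5 | lra].
apply: (runs_seti 0 p.+1); [evaluate | evaluate |].
exists (n - c.+1 + (n - p.+1))%N; first lia.
exists c.+1, p.+1, b5; split=> //; [by exists q5 | by split=> //; lia | lra |].
by split=> // q; lia.
Qed.

End Side.

(** * The two passes together *)

Lemma runs_augment_path :
  runs augment_path (init_store R n) (output_correct d).
Proof.
have size0 : ints (init_store R n) 0 0 = n by [].
apply: runs_seq; apply: (runs_seti 0 0); [by apply: ieval_num | by apply: ieval_num |].
apply: runs_seq; apply: (runs_compute_pos (sd := 0)) => //; first by left.
move=> s1 [out1 side1 _] pos1.
have size1 : ints s1 0 0 = n by rewrite out1.
have n1n : (n.-1 < n)%N by lia.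
have last_eval (s : store R) : ints s 0 0 = n -> ieval W s last_exp = Some n.-1.
  by move=> size_s; apply: (@ieval_pred s size_exp n) => //; apply: ieval_var.
apply: runs_seq; apply: (runs_setr 0 (pos (flip_dist 0 (ndist d)) n.-1)).
- exact: ieval_num.
- by apply: reval_load; [exact: last_eval | exact: pos1].
apply: runs_seq; apply: (runs_seti 3 0); [exact: ieval_num | exact: ieval_num |].
apply: runs_seq; apply: runs_seq; apply: (runs_seti 1 0); [exact: ieval_num | exact: ieval_num |].
apply: (runs_seti 2 1); [exact: ieval_num | exact: ieval_num |].
set s2 := store_int _ _ _ _.
have n_gt0 : (0 < n)%N by lia.
have D0_metric := ndist_metric d_metric.
have F0_metric : metric_below n (flip_dist 0 (ndist d)).
  by apply: flip_dist_metric => //; left.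
have saved2 : saved s2.
  exists (Ordinal n_gt0), (Ordinal n_gt1), (Ordinal n_gt0); split=> //.
  apply: ecc_le_reach => // v vn; left.
  rewrite [pos _ (Ordinal n_gt0)]pos0 subr0.
  have e0 x : flip 0 x = x by rewrite /flip; lia.
  have -> : reals s2 0 0 = pos (ndist d) n.-1.
    rewrite /s2 /= /update /= /pos; apply: eq_bigr => i _.
    by rewrite /flip_dist !e0.
  have := pos_mono D0_metric (leq0n v) vn; rewrite pos0 => pos_ge0.
  by rewrite ger0_norm //; apply: (pos_mono D0_metric); lia.
apply: runs_seq; apply: (runs_compute_mid (sd := 0)) => //; first by left.
move=> s3 [out3 side3 reals3] pos3 mid3.
have saved3 : saved s3.
  by case: saved2 => i [j [c h]]; exists i, j, c; rewrite out3 reals3.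
apply: runs_seq; apply: (runs_search (sd := 0)) => //; first by left.
- by rewrite out3.
- by rewrite side3 /= /update /= side1.
move=> s4 size4 saved4 _ min4.
apply: runs_seq; apply: (runs_seti 0 n.-1); [exact: ieval_num | exact: last_eval |].
apply: runs_seq; apply: (runs_compute_pos (sd := n.-1)) => //; first by right.
move=> s5 [out5 side5 reals5] pos5.
apply: runs_seq; apply: (runs_compute_mid (sd := n.-1)) => //; first by right.
  by rewrite out5.
move=> s6 [out6 side6 reals6] pos6 mid6.
have saved6 : saved s6.
  by case: saved4 => i [j [c h]]; exists i, j, c; rewrite out6 reals6 out5 reals5.
apply: (runs_search (sd := n.-1)) => //; first by right.
- by rewrite out6 out5.
- by rewrite side6 side5.
rewrite reals6 reals5 /= => s7 size7 [i [j [c [i7 j7 c7 ij ecc7]]]] le7 min7.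
exists i, j, c; split=> //; apply: optimal_of_reach => // a b E ab abE.
(* The first pass covers edges from the center to a later vertex, the second those to an earlier
   one. *)
have [lt|gt|/val_inj eq] := ltngtP a b; last by rewrite eq eqxx in ab.
  apply: le_trans le7 _; apply: (min4 a b); first by rewrite lt ltn_ord.
  by apply/(reach_flip (s := 0)) => //; [left | rewrite /flip !sub0n !subn0].
have an := ltn_ord a; have bn := ltn_ord b.
apply: (min7 (flip n.-1 a) (flip n.-1 b)); first by rewrite /flip; lia.
apply/(reach_flip (s := n.-1)) => //; [by right | | |].
- by apply: flip_lt => //; right.
- by apply: flip_lt => //; right.
by rewrite !(flipK (or_intror erefl)).
Qed.

End Program.

(* A single program, uniform in n and in the metric, on words of k * log2(n) bits
   for a constant k, halting after at most C * n units of time. *)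
Theorem theorem1 :
  exists (prog : cmd) (C k : nat),
    forall (R : realType) (n : nat) (d : 'I_n -> 'I_n -> R),
      (2 <= n)%N -> is_metric d ->
      exists (t : nat) (s : store R),
        [/\ exec d (n ^ k)%N prog (init_store R n) t s,
            (t <= C * n)%N
          & output_correct d s].
Proof.
(* Loops are not nested, so the time bound has the form [A * m.+1 + B]. With [m = n + n] it is at
   most [n] times its value [A * 3 + B] at [m = 2]. *)
exists augment_path, (cost_bound 2 augment_path), 2%N => R n d n_gt1 d_metric.
have [t [s [h le out]]] := runs_augment_path n_gt1 d_metric.
exists t, s; split=> //; apply: leq_trans le _.
by rewrite /=; lia.
Qed.
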